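(* Suppose that $\Sigma_s$ is nonsingular. Then the reduced KKT linear system $$\underbrace{\begin{bmatrix} \hat{W}_{uu}+\Sigma_u & 0 & \hat{A}_u^\top \\ 0 & \Sigma_s & -I \\ \hat{A}_u & -I & 0 \end{bmatrix}}_{K_{red}} \begin{bmatrix} \bm{p}_u \\ \bm{p}_s \\ \bm{p}_y \end{bmatrix} = - \begin{bmatrix} \hat{\bm{r}}_1 \\ \hat{\bm{r}}_2 \\ \hat{\bm{r}}_3 \end{bmatrix}$$ is equivalent to $$\underbrace{\big(\hat{W}_{uu} + \hat{A}_u^\top \Sigma_s \hat{A}_u\big)}_{K_{cond}}\,\bm{p}_u = -\big(\hat{\bm{r}}_1 + \hat{A}_u^\top \Sigma_s \hat{\bm{r}}_3 - \hat{A}_u^\top \hat{\bm{r}}_2\big),$$ the slack and multiplier descent directions being recovered as $$\bm{p}_y = \Sigma_s\big(\hat{A}_u\bm{p}_u + \hat{\bm{r}}_3 - \Sigma_s^{-1}\hat{\bm{r}}_2\big), \qquad \bm{p}_s = \Sigma_s^{-1}(\bm{p}_y - \hat{\bm{r}}_2).$$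
   Context: Consider $\min_{\bm{x},\bm{u},\bm{s}} f(\bm{x},\bm{u})$ subject to $\bm{u}\ge 0$, $\bm{x}\ge 0$, $\bm{s}\ge 0$, $g(\bm{x},\bm{u})=0$, $h(\bm{x},\bm{u})+\bm{s}=0$, with state $\bm{x}\in\mathbb{R}^{n_x}$, control $\bm{u}\in\mathbb{R}^{n_u}$, slack $\bm{s}\in\mathbb{R}^m$, and twice continuously differentiable functions $f:\mathbb{R}^{n_x}\times\mathbb{R}^{n_u}\to\mathbb{R}$, $g:\mathbb{R}^{n_x}\times\mathbb{R}^{n_u}\to\mathbb{R}^{n_x}$, $h:\mathbb{R}^{n_x}\times\mathbb{R}^{n_u}\to\mathbb{R}^m$. The Lagrangian is $$L = f(\bm{x},\bm{u}) + \bm{\lambda}^\top g(\bm{x},\bm{u}) + \bm{y}^\top(h(\bm{x},\bm{u})+\bm{s}) - \bm{v}^\top\bm{x} - \bm{w}^\top\bm{u} - \bm{z}^\top\bm{s},$$ with multipliers $\bm{\lambda}\in\mathbb{R}^{n_x}$, $\bm{y}\in\mathbb{R}^m$, $\bm{v}\in\mathbb{R}^{n_x}$, $\bm{w}\in\mathbb{R}^{n_u}$, $\bm{z}\in\mathbb{R}^m$. All derivatives are evaluated at the current interior-point iterate, at which $\bm{x},\bm{u},\bm{s}$ have positive entries. $\bm{g}_u,\bm{g}_x$ are the gradients of $f$ with respect to $\bm{u},\bm{x}$; $G_u\in\mathbb{R}^{n_x\times n_u}$, $G_x\in\mathbb{R}^{n_x\times n_x}$ are the partial Jacobians of $g$;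 $A_u\in\mathbb{R}^{m\times n_u}$, $A_x\in\mathbb{R}^{m\times n_x}$ are the partial Jacobians of $h$; and $W_{uu},W_{ux},W_{xu},W_{xx}$ are the blocks of the Hessian of $L$ with respect to $(\bm{u},\bm{x})$. The Jacobian $G_x$ is assumed invertible, and $G_x^{-\top}=(G_x^{-1})^\top$. $X,U,S$ denote the diagonal matrices with diagonals $\bm{x},\bm{u},\bm{s}$. The diagonal matrices $\Sigma_u,\Sigma_x,\Sigma_s$ are $\Sigma_u=U^{-1}\mathrm{diag}(\bm{w})$, $\Sigma_x=X^{-1}\mathrm{diag}(\bm{v})$, $\Sigma_s=S^{-1}\mathrm{diag}(\bm{z})$. $I$ is the identity matrix of size $m$. The reduced Hessian and reduced Jacobian are $$\hat{W}_{uu} = W_{uu} - W_{ux} G_x^{-1} G_u - G_u^\top G_x^{-\top} W_{xu} + G_u^\top G_x^{-\top} (W_{xx} + \Sigma_x) G_x^{-1} G_u, \qquad \hat{A}_u = A_u - A_x G_x^{-1} G_u .$$ With barrier parameter $\mu>0$ and $\bm{e}_n$ the all-ones vector of dimension $n$, set $\bm{r}_1=\bm{g}_u+G_u^\top\bm{\lambda}+A_u^\top\bm{y}-\mu U^{-1}\bm{e}_{n_u}$, $\bm{r}_2=\bm{g}_x+G_x^\top\bm{\lambda}+A_x^\top\bm{y}-\mu X^{-1}\bm{e}_{n_x}$, $\bm{r}_3=\bm{y}-\mu S^{-1}\bm{e}_m$, $\bm{r}_4=g(\bm{x},\bm{u})$, $\bm{r}_5=h(\bm{x},\bm{u})+\bm{s}$,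 and $$\hat{\bm{r}}_1 = \bm{r}_1 - G_u^\top G_x^{-\top} \bm{r}_2 - \big(W_{ux} - G_u^\top G_x^{-\top}(W_{xx}+\Sigma_x)\big) G_x^{-1} \bm{r}_4, \quad \hat{\bm{r}}_2 = \bm{r}_3, \quad \hat{\bm{r}}_3 = \bm{r}_5 - A_x G_x^{-1} \bm{r}_4.$$ The unknowns $\bm{p}_u\in\mathbb{R}^{n_u}$, $\bm{p}_s\in\mathbb{R}^m$, $\bm{p}_y\in\mathbb{R}^m$ are the descent directions in the control $\bm{u}$, the slack $\bm{s}$ and the multiplier $\bm{y}$. The matrix $K_{cond}$ has size $n_u\times n_u$.
   Formalization: The printed formulas contradict K_red. The theorem keeps K_red but adds Σ_u to K_cond (Ŵ_uu + Σ_u + Â_uᵀΣ_sÂ_u) and flips the sign of r̂_2: +Â_uᵀr̂_2 in the condensed right-hand side and +Σ_s⁻¹r̂_2 in the formula for p_y. *)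

(* Defs.v *)
From mathcomp Require Import all_boot all_order all_algebra.
From mathcomp Require Import all_classical all_reals all_analysis.
Set Implicit Arguments.
Unset Strict Implicit.
Unset Printing Implicit Defensive.
Import Order.TTheory GRing.Theory Num.Theory.
Import numFieldNormedType.Exports.
Local Open Scope ring_scope.
Local Open Scope classical_set_scope.

(* On finite-dimensional spaces, continuity of p |-> 'D_v F p for every v is
   continuity of the differential p |-> 'd F p. *)
Definition C1 (R : realType) (V W : normedModType R) (F : V -> W) : Prop :=
  (forall p, differentiable F p) /\ (forall v, continuous ('D_v F)).

Definition C2 (R : realType) (V W : normedModType R) (F : V -> W) : Prop :=
  C1 F /\ (forall v, C1 ('D_v F)).

Section Partial.
Variables (R : realType) (nx nu : nat).
Notation point := ('cV[R]_nx * 'cV[R]_nu)%type.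
Implicit Types (f : point -> R) (p : point).

Definition dirx (j : 'I_nx) : point := (delta_mx j 0, 0).
Definition diru (j : 'I_nu) : point := (0, delta_mx j 0).

Definition grad_x f p : 'cV[R]_nx := \col_j 'D_(dirx j) f p.
Definition grad_u f p : 'cV[R]_nu := \col_j 'D_(diru j) f p.

Definition jac_x k (F : point -> 'cV[R]_k) p : 'M[R]_(k, nx) :=
  \matrix_(i, j) 'D_(dirx j) (fun q => F q i 0) p.
Definition jac_u k (F : point -> 'cV[R]_k) p : 'M[R]_(k, nu) :=
  \matrix_(i, j) 'D_(diru j) (fun q => F q i 0) p.

Definition hess_uu f p : 'M[R]_(nu, nu) :=
  \matrix_(i, j) 'D_(diru i) ('D_(diru j) f) p.
Definition hess_ux f p : 'M[R]_(nu, nx) :=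
  \matrix_(i, j) 'D_(diru i) ('D_(dirx j) f) p.
Definition hess_xu f p : 'M[R]_(nx, nu) :=
  \matrix_(i, j) 'D_(dirx i) ('D_(diru j) f) p.
Definition hess_xx f p : 'M[R]_(nx, nx) :=
  \matrix_(i, j) 'D_(dirx i) ('D_(dirx j) f) p.

End Partial.

(* min f(x,u)  s.t.  u >= 0, x >= 0, s >= 0, g(x,u) = 0, h(x,u) + s = 0 *)
Record problem (R : realType) (nx nu m : nat) := Problem {
  obj : 'cV[R]_nx * 'cV[R]_nu -> R;            (* f *)
  eqc : 'cV[R]_nx * 'cV[R]_nu -> 'cV[R]_nx;    (* g *)
  ineqc : 'cV[R]_nx * 'cV[R]_nu -> 'cV[R]_m }. (* h *)

Record iterate (R : realType) (nx nu m : nat) := Iterate {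
  itx : 'cV[R]_nx;
  itu : 'cV[R]_nu;
  its : 'cV[R]_m;
  itlam : 'cV[R]_nx;
  ity : 'cV[R]_m;
  itv : 'cV[R]_nx;
  itw : 'cV[R]_nu;
  itz : 'cV[R]_m }.

Definition twice_cont_diff (R : realType) nx nu m (P : problem R nx nu m) :=
  [/\ C2 (obj P), C2 (eqc P) & C2 (ineqc P)].

Definition positive_vec (R : realType) n (a : 'cV[R]_n) : Prop :=
  forall i, 0 < a i 0.

Definition interior_iterate (R : realType) nx nu m (it : iterate R nx nu m) : Prop :=
  [/\ positive_vec (itx it), positive_vec (itu it) & positive_vec (its it)].

Definition dotv (R : realType) n (a b : 'cV[R]_n) : R := (a^T *m b) 0 0.

Definition diagc (R : realType) n (a : 'cV[R]_n) : 'M[R]_n := diag_mx a^T.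

Section KKT.
Variables (R : realType) (nx nu m : nat).
Variables (P : problem R nx nu m) (it : iterate R nx nu m) (mu : R).

Notation x := (itx it).
Notation u := (itu it).
Notation s := (its it).
Notation lam := (itlam it).
Notation y := (ity it).
Notation v := (itv it).
Notation w := (itw it).
Notation z := (itz it).

(* The Lagrangian as a function of (x, u), at the slack and multipliers of
   the iterate. *)
Definition Lagr (q : 'cV[R]_nx * 'cV[R]_nu) : R :=
  obj P q + dotv lam (eqc P q) + dotv y (ineqc P q + s)
  - dotv v q.1 - dotv w q.2 - dotv z s.

Definition gx := grad_x (obj P) (x, u).
Definition gu := grad_u (obj P) (x, u).
Definition Gx := jac_x (eqc P) (x, u).
Definition Gu := jac_u (eqc P) (x, u).
Definition Ax := jac_x (ineqc P) (x, u).
Definition Au := jac_u (ineqc P) (x, u).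
Definition Wuu := hess_uu Lagr (x, u).
Definition Wux := hess_ux Lagr (x, u).
Definition Wxu := hess_xu Lagr (x, u).
Definition Wxx := hess_xx Lagr (x, u).

Definition Sigma_u : 'M[R]_nu := invmx (diagc u) *m diagc w.
Definition Sigma_x : 'M[R]_nx := invmx (diagc x) *m diagc v.
Definition Sigma_s : 'M[R]_m := invmx (diagc s) *m diagc z.

Definition GxV := invmx Gx.
Definition GxVT := GxV^T.

Definition What : 'M[R]_nu :=
  Wuu - Wux *m GxV *m Gu - Gu^T *m GxVT *m Wxu
  + Gu^T *m GxVT *m (Wxx + Sigma_x) *m GxV *m Gu.
Definition Ahat : 'M[R]_(m, nu) := Au - Ax *m GxV *m Gu.

Definition r1 : 'cV[R]_nu :=
  gu + Gu^T *m lam + Au^T *m y - mu *: (invmx (diagc u) *m const_mx 1).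
Definition r2 : 'cV[R]_nx :=
  gx + Gx^T *m lam + Ax^T *m y - mu *: (invmx (diagc x) *m const_mx 1).
Definition r3 : 'cV[R]_m := y - mu *: (invmx (diagc s) *m const_mx 1).
Definition r4 : 'cV[R]_nx := eqc P (x, u).
Definition r5 : 'cV[R]_m := ineqc P (x, u) + s.

Definition rhat1 : 'cV[R]_nu :=
  r1 - Gu^T *m GxVT *m r2
  - (Wux - Gu^T *m GxVT *m (Wxx + Sigma_x)) *m GxV *m r4.
Definition rhat2 : 'cV[R]_m := r3.
Definition rhat3 : 'cV[R]_m := r5 - Ax *m GxV *m r4.

Definition Kred : 'M[R]_(nu + (m + m)) :=
  col_mx (row_mx (What + Sigma_u) (row_mx 0 Ahat^T))
  (col_mx (row_mx 0 (row_mx Sigma_s (- 1%:M)))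
          (row_mx Ahat (row_mx (- 1%:M) 0))).

(* Corrected: the published formula lacks Sigma_u, but eliminating the slack
   and multiplier blocks of Kred leaves it in place.  For the same reason rhat2
   enters the condensed right-hand side and the formula for p_y with the
   opposite sign to the published one, which is inconsistent with the -I
   blocks of Kred. *)
Definition Kcond : 'M[R]_nu := What + Sigma_u + Ahat^T *m Sigma_s *m Ahat.

End KKT.

(* Main.v *)
Require Import Defs.
From mathcomp Require Import all_boot all_order all_algebra.
From mathcomp Require Import all_classical all_reals all_analysis.
Import Order.TTheory GRing.Theory Num.Theory.
Import numFieldNormedType.Exports.
Local Open Scope ring_scope.

(** The system is three block equations,
    [H pu + A^T py = - r1], [S ps - py = - r2] and [A pu - ps = - r3].
    The third one says [ps = A pu + r3], because its slack block is [-I]; the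
    second one then gives [py = S ps + r2 = S (A pu + r3) + r2]; substituting
    this [py] in the first one leaves an equation in [pu] alone, whose matrix
    [H + A^T S A] is the Schur complement of the slack and multiplier blocks.
    Each substitution is reversible once [S] is invertible, which is what lets
    [ps] be read off [py] and [r2 = S (S^-1 r2)] be moved inside the product
    by [S].  This is linear algebra on the blocks [H], [A], [S] and the
    right-hand side; [condense_slack_multiplier] carries it out, to be applied
    with [H] the sum of the reduced Hessian and [Sigma_u]. *)

(** Gaussian elimination of the slack block and then of the multiplier
    block. *)
Lemma condense_slack_multiplier (R : comUnitRingType) (n m : nat)
  (H : 'M[R]_n) (A : 'M[R]_(m, n)) (S : 'M[R]_m)
  (r1 : 'cV[R]_n) (r2 r3 : 'cV[R]_m) (pu : 'cV[R]_n) (ps py : 'cV[R]_m) :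
  S \in unitmx ->
  col_mx (row_mx H (row_mx 0 A^T))
    (col_mx (row_mx 0 (row_mx S (- 1%:M)))
            (row_mx A (row_mx (- 1%:M) 0))) *m col_mx pu (col_mx ps py)
    = - col_mx r1 (col_mx r2 r3)
  <->
  [/\ (H + A^T *m S *m A) *m pu = - (r1 + A^T *m S *m r3 + A^T *m r2),
      py = S *m (A *m pu + r3 + invmx S *m r2)
    & ps = invmx S *m (py - r2)].
Proof.
move=> S_unit.
have pyE : S *m (A *m pu + r3 + invmx S *m r2) = S *m (A *m pu + r3) + r2.
  by rewrite mulmxDr mulKVmx.
rewrite pyE !mul_col_mx !mul_row_col !mul0mx !mulNmx !mul1mx !add0r !addr0.
rewrite !opp_col_mx.
(* With [py] in closed form, the first block row and the condensed equation
   differ only by terms moved across the equality. *)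
have rowE : H *m pu + A^T *m (S *m (A *m pu + r3) + r2) + r1
    = (H + A^T *m S *m A) *m pu + (r1 + A^T *m S *m r3 + A^T *m r2).
  rewrite !mulmxDr mulmxDl !mulmxA -!addrA; do 2!congr (_ + _).
  by rewrite addrA addrC.
split=> [/eq_col_mx[eq1 /eq_col_mx[eq2 eq3]] | [eq_cond def_py def_ps]].
  have def_ps : ps = A *m pu + r3.
    by apply/esym/eqP; rewrite -subr_eq0 addrAC eq3 addNr.
  have def_py : py = S *m ps + r2.
    by apply/esym/eqP; rewrite -subr_eq0 addrAC eq2 addNr.
  split; last by rewrite def_py addrK mulKmx.
    by apply/eqP; rewrite -addr_eq0 -rowE -def_ps -def_py eq1 addNr.
  by rewrite -def_ps.
have ps_row : ps = A *m pu + r3 by rewrite def_ps def_py addrK mulKmx.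
congr col_mx; last congr col_mx.
- by apply/eqP; rewrite -addr_eq0 def_py rowE eq_cond addNr.
- by rewrite def_py -ps_row opprD addNKr.
- by rewrite ps_row opprD addNKr.
Qed.

Theorem theorem2p2 (R : realType) (nx nu m : nat)
  (P : problem R nx nu m) (it : iterate R nx nu m) (mu : R)
  (P_C2 : twice_cont_diff P) (it_int : interior_iterate it) (mu_gt0 : 0 < mu)
  (Gx_inv : Gx P it \in unitmx) (Sigma_s_inv : Sigma_s it \in unitmx)
  (pu : 'cV[R]_nu) (ps py : 'cV[R]_m) :
  Kred P it *m col_mx pu (col_mx ps py)
    = - col_mx (rhat1 P it mu) (col_mx (rhat2 it mu) (rhat3 P it))
  <->
  [/\ Kcond P it *m pu
        = - (rhat1 P it mu + (Ahat P it)^T *m Sigma_s it *m rhat3 P it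
             + (Ahat P it)^T *m rhat2 it mu),
      py = Sigma_s it *m (Ahat P it *m pu + rhat3 P it
                          + invmx (Sigma_s it) *m rhat2 it mu)
    & ps = invmx (Sigma_s it) *m (py - rhat2 it mu)].
Proof. exact: condense_slack_multiplier. Qed.
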